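(* Let $k$ be a field, let $a\ge 1$, $d\ge 1$ and $b\in\{1,2,3\}$ be integers, put $m_0=3a+b$, $m_i=m_0+id$ for $i=1,2,3$, and assume $\gcd(m_0,m_1,m_2,m_3)=1$. Let $C$ be the monomial curve with parametrization $x_0=t^{m_0},\ x_1=t^{m_1},\ x_2=t^{m_2},\ y=t^{m_3}$ and defining ideal $I(C)\subset k[x_0,x_1,x_2,y]$. Then $C$ has Cohen-Macaulay tangent cone at the origin, i.e. the ring $k[x_0,x_1,x_2,y]/I(C)^*$ is Cohen-Macaulay.
   Context: $I(C)$ is the kernel of the $k$-algebra homomorphism $k[x_0,x_1,x_2,y]\to k[t]$, $x_0\mapsto t^{m_0}$, $x_1\mapsto t^{m_1}$, $x_2\mapsto t^{m_2}$, $y\mapsto t^{m_3}$. For a nonzero polynomial $f$, $f^*$ denotes its homogeneous summand of least degree (all variables have degree 1), and $I(C)^*$ is the ideal generated by all $f^*$ with $0\neq f\in I(C)$; it is the defining ideal of the tangent cone of $C$ at the origin, and $k[x_0,x_1,x_2,y]/I(C)^*$ is isomorphic to the associated graded ring of $k[[t^{m_0},t^{m_1},t^{m_2},t^{m_3}]]$ with respect to its maximal ideal. By a known theorem (Patil), $I(C)$ is minimally generated by the following set $G$, where $\xi_{11}=x_1^2-x_0x_2$, $\varphi_0=x_1x_2-x_0y$, $\varphi_1=x_2^2-x_1y$: if $b=1$, $G=\{\xi_{11},\varphi_0,\varphi_1,\ x_1y^a-x_0^{a+d+1},\ x_2y^a-x_0^{a+d}x_1,\ y^{a+1}-x_0^{a+d}x_2\}$;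 if $b=2$, $G=\{\xi_{11},\varphi_0,\varphi_1,\ x_2y^a-x_0^{a+d+1},\ y^{a+1}-x_0^{a+d}x_1\}$; if $b=3$, $G=\{\xi_{11},\varphi_0,\varphi_1,\ y^{a+1}-x_0^{a+d+1}\}$. *)

(* Defs.v *)
From HB Require Import structures.
From mathcomp Require Import all_boot all_algebra.
From mathcomp Require Import generic_quotient ring_quotient.
From mathcomp Require Import boolp ring.
From mathcomp Require Import mpoly.

Set Implicit Arguments.
Unset Strict Implicit.
Unset Printing Implicit Defensive.

Import GRing.Theory.

Local Open Scope ring_scope.
Local Open Scope quotient_scope.

Section Localization.

(* An ideal in ring_quotient.v is a boolean predicate; under the classical axioms
   of boolp this is no restriction, since [`[< _ >]] turns any Prop into one. *)
Variables (R : comNzRingType) (P : prime_idealr R).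

Definition loc_denom := {s : R | s \notin P}.
Definition loc_pair : Type := (R * loc_denom)%type.
HB.instance Definition _ := Choice.on loc_pair.

(* r/s = r'/s' iff u (r s' - r' s) = 0 for some u outside P. *)
Definition loc_equiv (x y : loc_pair) : bool :=
  `[< exists2 u, u \notin P & u * (x.1 * val y.2 - y.1 * val x.2) = 0 >].

Lemma loc_denom1P : 1 \notin P.
Proof. by rewrite idealr1. Qed.

Lemma loc_denomMP (s t : loc_denom) : val s * val t \notin P.
Proof. by rewrite prime_idealrM negb_or (valP s) (valP t). Qed.

Definition loc_denom1 : loc_denom := Sub 1 loc_denom1P.
Definition loc_denomM (s t : loc_denom) : loc_denom :=
  Sub (val s * val t) (loc_denomMP s t).

Lemma val_loc_denom1 : val loc_denom1 = 1.
Proof. by []. Qed.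

Lemma val_loc_denomM s t : val (loc_denomM s t) = val s * val t.
Proof. by []. Qed.

Let val_denomE := (val_loc_denom1, val_loc_denomM).

Lemma loc_equiv_is_equiv : equiv_class_of loc_equiv.
Proof.
have sym x y : loc_equiv x y -> loc_equiv y x.
  move=> /asboolP[u uP e]; apply/asboolP; exists u => //.
  by rewrite -[RHS]oppr0 -e; ring.
split=> [x|x y|y x z].
- by apply/asboolP; exists 1; rewrite ?loc_denom1P // subrr mulr0.
- by apply/idP/idP => /sym.
move=> /asboolP[u uP exy] /asboolP[v vP eyz]; apply/asboolP.
exists (u * v * val y.2).
  by rewrite !prime_idealrM !negb_or uP vP (valP y.2).
transitivity (v * val z.2 * (u * (x.1 * val y.2 - y.1 * val x.2)) +
              u * val x.2 * (v * (y.1 * val z.2 - z.1 * val y.2))).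
  by ring.
by rewrite exy eyz !mulr0 addr0.
Qed.

Canonical loc_equiv_equiv := EquivRelPack loc_equiv_is_equiv.
Canonical loc_equiv_encModRel := defaultEncModRel loc_equiv.

Definition localization := {eq_quot loc_equiv}.
HB.instance Definition _ : EqQuotient loc_pair loc_equiv localization :=
  EqQuotient.on localization.
HB.instance Definition _ := Choice.on localization.

Definition loc_frac (r : R) (s : loc_denom) : localization :=
  \pi_localization (r, s).

Lemma loc_fracP r s r' s' :
  (loc_frac r s = loc_frac r' s') <->
  (exists2 u, u \notin P & u * (r * val s' - r' * val s) = 0).
Proof.
split=> [/eqP|h]; last by apply/eqP; rewrite eqmodE; apply/asboolP.
by rewrite eqmodE => /asboolP.
Qed.

Lemma loc_fracE (x : localization) : exists r s, x = loc_frac r s.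
Proof.
exists (repr x).1, (repr x).2.
by rewrite /loc_frac -surjective_pairing reprK.
Qed.

Definition loc_add (x y : localization) : localization :=
  let: (r, s) := repr x in let: (r', s') := repr y in
  loc_frac (r * val s' + r' * val s) (loc_denomM s s').
Definition loc_opp (x : localization) : localization :=
  let: (r, s) := repr x in loc_frac (- r) s.
Definition loc_mul (x y : localization) : localization :=
  let: (r, s) := repr x in let: (r', s') := repr y in
  loc_frac (r * r') (loc_denomM s s').

Lemma loc_repr r s : exists r' s', repr (loc_frac r s) = (r', s') /\
  exists2 u, u \notin P & u * (r' * val s - r * val s') = 0.
Proof.
case E: (repr _) => [r' s']; exists r', s'; split=> //.
by apply/loc_fracP; rewrite /loc_frac -E reprK.
Qed.

Lemma loc_addE r s r' s' : loc_add (loc_frac r s) (loc_frac r' s') =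
  loc_frac (r * val s' + r' * val s) (loc_denomM s s').
Proof.
rewrite /loc_add; have [q [t [-> [u uP e]]]] := loc_repr r s.
have [q' [t' [-> [u' uP' e']]]] := loc_repr r' s'.
apply/loc_fracP; exists (u * u'); first by rewrite prime_idealrM negb_or uP.
rewrite !val_denomE.
transitivity (u' * val s' * val t' * (u * (q * val s - r * val t)) +
  u * val s * val t * (u' * (q' * val s' - r' * val t'))); first by ring.
by rewrite e e' !mulr0 addr0.
Qed.

Lemma loc_oppE r s : loc_opp (loc_frac r s) = loc_frac (- r) s.
Proof.
rewrite /loc_opp; have [q [t [-> [u uP e]]]] := loc_repr r s.
apply/loc_fracP; exists u => //.
by transitivity (- (u * (q * val s - r * val t))); [ring | rewrite e oppr0].
Qed.

Lemma loc_mulE r s r' s' : loc_mul (loc_frac r s) (loc_frac r' s') =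
  loc_frac (r * r') (loc_denomM s s').
Proof.
rewrite /loc_mul; have [q [t [-> [u uP e]]]] := loc_repr r s.
have [q' [t' [-> [u' uP' e']]]] := loc_repr r' s'.
apply/loc_fracP; exists (u * u'); first by rewrite prime_idealrM negb_or uP.
rewrite !val_denomE.
transitivity (u' * q' * val s' * (u * (q * val s - r * val t)) +
  u * r * val t * (u' * (q' * val s' - r' * val t'))); first by ring.
by rewrite e e' !mulr0 addr0.
Qed.

Let frac_eq r s r' s' : r * val s' = r' * val s -> loc_frac r s = loc_frac r' s'.
Proof.
by move=> e; apply/loc_fracP; exists 1; rewrite ?loc_denom1P // e subrr mulr0.
Qed.

Lemma loc_addA : associative loc_add.
Proof.
move=> x y z; have [a [s ->]] := loc_fracE x; have [b [t ->]] := loc_fracE y.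
have [c [u ->]] := loc_fracE z; rewrite !loc_addE.
apply: frac_eq; rewrite !val_denomE; ring.
Qed.

Lemma loc_addC : commutative loc_add.
Proof.
move=> x y; have [a [s ->]] := loc_fracE x; have [b [t ->]] := loc_fracE y.
rewrite !loc_addE; apply: frac_eq; rewrite !val_denomE; ring.
Qed.

Lemma loc_add0 : left_id (loc_frac 0 loc_denom1) loc_add.
Proof.
move=> x; have [a [s ->]] := loc_fracE x.
rewrite !loc_addE; apply: frac_eq; rewrite !val_denomE; ring.
Qed.

Lemma loc_addN : left_inverse (loc_frac 0 loc_denom1) loc_opp loc_add.
Proof.
move=> x; have [a [s ->]] := loc_fracE x.
rewrite loc_oppE !loc_addE; apply: frac_eq; rewrite !val_denomE; ring.
Qed.

HB.instance Definition _ :=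
  GRing.isZmodule.Build localization loc_addA loc_addC loc_add0 loc_addN.

Lemma loc_mulA : associative loc_mul.
Proof.
move=> x y z; have [a [s ->]] := loc_fracE x; have [b [t ->]] := loc_fracE y.
have [c [u ->]] := loc_fracE z; rewrite !loc_mulE.
apply: frac_eq; rewrite !val_denomE; ring.
Qed.

Lemma loc_mulC : commutative loc_mul.
Proof.
move=> x y; have [a [s ->]] := loc_fracE x; have [b [t ->]] := loc_fracE y.
rewrite !loc_mulE; apply: frac_eq; rewrite !val_denomE; ring.
Qed.

Lemma loc_mul1 : left_id (loc_frac 1 loc_denom1) loc_mul.
Proof.
move=> x; have [a [s ->]] := loc_fracE x.
rewrite !loc_mulE; apply: frac_eq; rewrite !val_denomE; ring.
Qed.

Lemma loc_mulDl : left_distributive loc_mul +%R.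
Proof.
move=> x y z; have [a [s ->]] := loc_fracE x; have [b [t ->]] := loc_fracE y.
have [c [u ->]] := loc_fracE z.
have addE (v w : localization) : v + w = loc_add v w by [].
rewrite !addE loc_addE !loc_mulE loc_addE.
apply: frac_eq; rewrite !val_denomE; ring.
Qed.

Lemma loc_1_neq0 : loc_frac 1 loc_denom1 != 0.
Proof.
apply/eqP => /loc_fracP[u uP]; rewrite val_denomE mul0r subr0 !mulr1 => u0.
by move: uP; rewrite u0 rpred0.
Qed.

HB.instance Definition _ := GRing.Zmodule_isComNzRing.Build localization
  loc_mulA loc_mulC loc_mul1 loc_mulDl loc_1_neq0.

End Localization.

Section CohenMacaulay.

Implicit Type R A : comNzRingType.

Definition ideal_span R (S : R -> Prop) (x : R) : Prop :=
  exists s : seq (R * R),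
    (forall p, p \in s -> S p.2) /\ x = \sum_(p <- s) p.1 * p.2.

(* [idealr R] is the type of proper ideals; the unit ideal needs no condition,
   being generated by 1. *)
Definition noetherian R : Prop :=
  forall I : idealr R, exists s : seq R,
    forall x, x \in I <-> ideal_span (fun y => y \in s) x.

Definition maximal_ideal R (M : idealr R) : Prop :=
  forall J : idealr R, {subset M <= J} -> {subset J <= M}.

Definition prime_chain R (n : nat) (Q : 'I_n.+1 -> prime_idealr R) : Prop :=
  forall i j : 'I_n.+1, (i < j)%N ->
    {subset Q i <= Q j} /\ ~ {subset Q j <= Q i}.

Definition has_krull_dim R (n : nat) : Prop :=
  (exists Q : 'I_n.+1 -> prime_idealr R, prime_chain Q) /\
  (forall l (Q : 'I_l.+1 -> prime_idealr R), prime_chain Q -> (l <= n)%N).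

(* Each xs_i is a nonzerodivisor on R/(xs_0, ..., xs_(i-1)) and R/(xs) != 0. *)
Definition regular_sequence R (xs : seq R) : Prop :=
  (forall i, (i < size xs)%N -> forall r,
     ideal_span (fun y => y \in take i xs) (r * xs`_i) ->
     ideal_span (fun y => y \in take i xs) r) /\
  ~ ideal_span (fun y => y \in xs) 1.

Definition has_depth R (M : idealr R) (n : nat) : Prop :=
  (exists xs : seq R,
     [/\ size xs = n, {subset xs <= M} & regular_sequence xs]) /\
  (forall xs : seq R,
     {subset xs <= M} -> regular_sequence xs -> (size xs <= n)%N).

Definition local_ring_at A (M : idealr A) : Prop :=
  maximal_ideal M /\ (forall J : idealr A, maximal_ideal J -> J =i M).

Definition cohen_macaulay_local A : Prop :=
  noetherian A /\
  exists M : idealr A,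
    local_ring_at M /\ exists n, has_krull_dim A n /\ has_depth M n.

Definition cohen_macaulay R : Prop :=
  noetherian R /\
  forall P : prime_idealr R, maximal_ideal P ->
    cohen_macaulay_local (localization P).

End CohenMacaulay.

Section TangentCone.

Variables (k : fieldType) (n : nat).
Implicit Types (m : 'I_n -> nat) (f g : {mpoly k[n]}).

(* The kernel of 'X_i |-> 'X^(m i). *)
Definition curve_ideal m : {pred {mpoly k[n]}} :=
  [pred f | mmap (@polyC k) (fun i => 'X^(m i)) f == 0].

(* Every total degree occurring in f is smaller than msize f, which thus only
   serves as a default value (reached for f = 0). *)
Definition least_degree f : nat :=
  \big[minn/msize f]_(e <- msupp f) mdeg e.

Definition initial_form f : {mpoly k[n]} := pihomog mdeg (least_degree f) f.

Definition tangent_cone_ideal m : {pred {mpoly k[n]}} := fun g =>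
  `[< ideal_span
        (fun h => exists f,
           [/\ f \in curve_ideal m, f != 0 & h = initial_form f])
        g >].

Lemma tangent_cone_ideal_closed m :
  (forall i, 0 < m i)%N -> idealr_closed (tangent_cone_ideal m).
Proof.
move=> m_gt0; split.
- by apply/asboolP; exists [::]; rewrite big_nil.
- apply/negP => /asboolP[s [sS]] /(congr1 (mcoeff 0)).
  rewrite raddf_sum /= mcoeff1 eqxx big_seq big1 => [/eqP|p /sS].
    by rewrite oner_eq0.
  move=> [f [+ _ ->]]; rewrite inE => /eqP fI.
  have f0 : f@_0 = 0.
    have := congr1 (fun q : {poly k} => q.[0]) fI.
    rewrite /mmap horner_sum horner0 => <-.
    have mon0 (e : 'X_{1..n}) : (mmap1 (fun i => 'X^(m i)) e).[0] = (e == 0%MM)%:R :> k.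
      rewrite /mmap1 horner_prod; case: eqP => [->|/eqP ne0].
        by rewrite big1 // => i _; rewrite mnm0E expr0 hornerC.
      have [i ei] : exists i, e i != 0%N.
        apply/existsP; apply: contraNT ne0; rewrite negb_exists => /forallP h.
        by apply/eqP/mnmP => i; rewrite mnm0E; apply/eqP; rewrite -[_ == _]negbK h.
      rewrite (bigD1 i) //= !horner_exp hornerX expr0n eqn0Ngt m_gt0 /=.
      by rewrite expr0n (negPf ei) mul0r.
    case: (boolP (0%MM \in msupp f)) => [f0s|/memN_msupp_eq0 f0].
      rewrite (bigD1_seq 0%MM) //= hornerM hornerC mon0 eqxx mulr1 big1 ?addr0 //.
      by move=> e /negPf e0; rewrite hornerM mon0 e0 mulr0.
    rewrite f0 big_seq big1 // => e es; rewrite hornerM hornerC mon0.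
    by case: eqP => [->|]; rewrite ?f0 ?mul0r ?mulr0.
  rewrite (rmorphM (mcoeff 0%MM)) /=.
  rewrite /initial_form /pihomog raddf_sum /= big1 ?mulr0 // => e _.
  by rewrite mcoeffZ mcoeffX; case: eqP => [->|]; rewrite ?f0 ?mul0r ?mulr0.
move=> a u v /asboolP[s [sS ->]] /asboolP[t [tS ->]]; apply/asboolP.
exists ([seq (a * p.1, p.2) | p <- s] ++ t); split.
  move=> p; rewrite mem_cat => /orP[/mapP[q qs ->]|]; last exact: tS.
  exact: sS qs.
rewrite big_cat big_map big_distrr /=; congr (_ + _).
by apply: eq_bigr => p _; rewrite mulrA.
Qed.

Definition tangent_cone_idealr m (m_gt0 : forall i, (0 < m i)%N) :
    idealr {mpoly k[n]} :=
  HB.pack (tangent_cone_ideal m)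
    (isIdealr.Build _ (tangent_cone_ideal m) (tangent_cone_ideal_closed m_gt0)).

Definition tangent_cone_ring m (m_gt0 : forall i, (0 < m i)%N) : comNzRingType :=
  {ideal_quot (tangent_cone_idealr m_gt0)}.

End TangentCone.

Arguments tangent_cone_ring k {n m} m_gt0.

Definition curve_exponent (a b d : nat) (i : 'I_4) : nat :=
  (3 * a + b + i * d)%N.

Lemma curve_exponent_gt0 (a b d : nat) :
  (0 < a)%N -> forall i, (0 < curve_exponent a b d i)%N.
Proof. by move=> a_gt0 i; rewrite /curve_exponent !addn_gt0 muln_gt0 a_gt0. Qed.

(* Main.v *)
From HB Require Import structures.
Require Import Defs.
From mathcomp Require Import all_boot all_algebra.
From mathcomp Require Import generic_quotient ring_quotient boolp ring zify mpoly.

(** Write R for the polynomial ring, T for the ideal of the tangent cone, A for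
    R/T and m0 = 3a + b.  The point is that A is a free k[x0]-module of finite
    rank whose reduction is k[x0]: the tangent cone is a thickening of the affine
    line, and such a ring is Cohen-Macaulay of dimension one.

    Freeness is a count of monomials.  A monomial with exponent vector e has
    weight m0 deg(e) + d nu(e), where nu(e) = e_1 + 2 e_2 + 3 e_3 is called
    [steps] below.  A binomial of monomials of equal weight lies in the curve
    ideal, so its initial form lies in T: monomials with the same degree and the
    same nu agree in A, and a monomial vanishes in A as soon as another one of the
    same weight has larger degree.  Since m0 deg + d nu is unchanged by
    (deg, nu) -> (deg + d, nu - m0), every monomial with nu >= m0 dies
    ([quo_monomial_high]), and a monomial with nu = i < m0 becomes x0^j S_i, where
    S_i is the monomial of least degree with nu = i ([quo_monomial_low]).
    So S_0, ..., S_(m0-1) generate A over k[x0].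

    They are independent because, as gcd(m0, d) = 1, the monomial x0^j S_i with
    i < m0 has the largest degree D among all monomials of its weight s
    ([normal_mono_mdeg_max]).  For such D and s, adding up the coefficients at the
    monomials of degree D and weight s is a linear form vanishing on T
    ([coef_param_tangent_cone]): if f is in the curve ideal and has order n, its
    coefficients of weight s sum to zero, and when no monomial of weight s has
    degree above n the only ones that contribute are those of degree n, that is
    those of the initial form.

    The rest is commutative algebra over a ring A containing k[X], torsion-free and
    finite over it, in which each element is a polynomial plus a nilpotent
    ([thick_line_cohen_macaulay]).  Such a ring is noetherian since k[X] is a
    principal ideal domain.  Localized at a maximal ideal, its primes are
    controlled by the polynomials they contain, so a chain has length at most one
    and the nilradical below the maximal ideal realizes that length; a nonzero
    polynomial in the maximal ideal is a regular sequence, and a regular pair is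
    excluded by a gcd argument ([regular_pair_false]).  That the maximal ideals of A
    contain a nonzero polynomial is [maximal_poly]. *)

Set Implicit Arguments.
Unset Strict Implicit.
Unset Printing Implicit Defensive.

Import GRing.Theory.
Local Open Scope ring_scope.
Local Open Scope quotient_scope.

(** * Nilpotent elements and prime ideals *)

Section Nilpotent.

Variable R : comNzRingType.
Implicit Types (x y z : R) (n : nat).

Definition nilpotent x : Prop := exists n, x ^+ n = 0.

Lemma nilpotent0 : nilpotent 0.
Proof. by exists 1%N; rewrite expr1. Qed.

Lemma nilpotentM x y : nilpotent x -> nilpotent (y * x).
Proof. by case=> n xn0; exists n; rewrite exprMn xn0 mulr0. Qed.

Lemma nilpotentD x y : nilpotent x -> nilpotent y -> nilpotent (x + y).
Proof.
case=> n xn0 [m ym0]; exists (n + m)%N; rewrite exprDn big1 // => i _.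
have [le_im | /ltnW lt_mi] := leqP i m.
  by rewrite -addnBA // exprD xn0 !mul0r mul0rn.
by rewrite -{2}(subnKC lt_mi) exprD ym0 mul0r mulr0 mul0rn.
Qed.

Lemma nilpotentN x : nilpotent x -> nilpotent (- x).
Proof. by rewrite -mulN1r; exact: nilpotentM. Qed.

Lemma nilpotentB x y : nilpotent x -> nilpotent y -> nilpotent (x - y).
Proof. by move=> xnil ynil; apply: nilpotentD => //; exact: nilpotentN. Qed.

Lemma nilpotent1 : ~ nilpotent 1.
Proof. by case=> n /eqP; rewrite expr1n oner_eq0. Qed.

Lemma mem_prime_exp (Q : prime_idealr R) x n : x ^+ n \in Q -> x \in Q.
Proof.
elim: n => [|n IHn]; first by rewrite expr0 idealr1.
by rewrite exprS prime_idealrM => /orP[|/IHn].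
Qed.

Lemma nilpotent_mem_prime (Q : prime_idealr R) x : nilpotent x -> x \in Q.
Proof. by case=> n xn0; apply: (@mem_prime_exp Q x n); rewrite xn0 rpred0. Qed.

Lemma mem_congr (Q : prime_idealr R) x y :
  nilpotent (x - y) -> (x \in Q) = (y \in Q).
Proof.
move=> /(nilpotent_mem_prime Q) xyQ.
by apply/idP/idP => h; [rewrite -[y](subKr x) rpredB | rewrite -[x](subrK y) rpredD].
Qed.

Lemma unit_notin (Q : idealr R) u v : u * v = 1 -> u \notin Q.
Proof.
move=> uv1; apply/negP => uQ.
by have := idealMr v uQ; rewrite mulrC uv1 idealr1.
Qed.

Lemma exp_sub_dvd z w n : exists c, z ^+ n = (z - w) ^+ n + c * w.
Proof.
exists (\sum_(i < n) z ^+ (n.-1 - i) * (z - w) ^+ i).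
by rewrite [_ * w]mulrC -[X in X * _](subKr z) -subrXX addrC subrK.
Qed.

End Nilpotent.

Lemma ideal_span1 (R : comNzRingType) (z x : R) :
  ideal_span (fun y => y \in [:: z]) x <-> exists c, x = c * z.
Proof.
split=> [[s [sS ->]] | [c ->]]; last first.
  by exists [:: (c, z)]; split=> [p|]; rewrite ?big_seq1 // !inE => /eqP->.
exists (\sum_(p <- s) p.1); rewrite big_distrl /= !big_seq.
by apply: eq_bigr => p /sS; rewrite inE => /eqP->.
Qed.

Lemma ideal_span_nil (R : comNzRingType) (x : R) :
  ideal_span (fun y => y \in [::]) x <-> x = 0.
Proof.
split=> [[s [sS ->]] | ->]; last by exists [::]; rewrite big_nil.
by rewrite big_seq big1 // => p /sS.
Qed.

(** * Chains of primes and regular sequences over a thickened line *)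

Section PolyGcd.
Variable k : fieldType.
Implicit Types f g : {poly k}.

(** Both Krull dimension and depth are bounded by descent on the size of a
    polynomial f, and this is the step of the descent: either f and g generate
    the unit ideal, or f is replaced by its proper factor e = f / gcd f g. *)
Lemma gcd_split f g : f != 0 ->
  (exists u v, u * f + v * g = 1) \/
  exists d e h u v, [/\ f = d * e, g = d * h, d = u * f + v * g,
                        (size e < size f)%N & e != 0].
Proof.
move=> f0; have [[u v] /= eq_gcd] := Bezoutp f g; set d := u * f + _ in eq_gcd.
have /dvdpP[e fe] : d %| f by rewrite (eqp_dvdl _ eq_gcd) dvdp_gcdl.
have /dvdpP[h gh] : d %| g by rewrite (eqp_dvdl _ eq_gcd) dvdp_gcdr.
have [e0 d0] : e != 0 /\ d != 0.
  by move: f0; rewrite fe mulf_eq0 negb_or => /andP.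
have [/size_poly1P[c c0 dc] | d1] := boolP (size d == 1%N).
  left; exists (c^-1%:P * u), (c^-1%:P * v).
  by rewrite -!mulrA -mulrDr -/d dc -polyCM mulVf.
right; exists d, e, h, u, v; split; rewrite // 1?mulrC //.
rewrite fe size_mul //; move: d1 d0; rewrite -size_poly_gt0.
by case: (size d) => [|[|n]] // _ _; rewrite !addnS ltnS leq_addr.
Qed.

End PolyGcd.

(** The ring L stands for a localization of a finite torsion-free k[X]-algebra
    whose reduction is k[X].  A fraction r/s is a polynomial plus a nilpotent only
    after multiplication by s, whence the unit u in the second hypothesis. *)
Section ThickLine.

Variables (k : fieldType) (L : comNzRingType) (iota : {rmorphism {poly k} -> L}).
Hypothesis iota_reg : forall f z, f != 0 -> iota f * z = 0 -> z = 0.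
Hypothesis iota_approx : forall x,
  exists u v f, u * v = 1 /\ nilpotent (u * x - iota f).

Lemma iota_nilpotent f : nilpotent (iota f) -> f = 0.
Proof.
case=> n; apply: contraPeq => f0.
rewrite -rmorphXn -[iota _]mulr1 => /iota_reg /eqP.
by rewrite expf_eq0 (negPf f0) andbF oner_eq0 => /(_ isT).
Qed.

Definition nilradical : {pred L} := fun x => `[< nilpotent x >].

Lemma nilradicalP x : reflect (nilpotent x) (x \in nilradical).
Proof. exact: asboolP. Qed.

Lemma nilradical_closed : idealr_closed nilradical.
Proof.
split; first exact/nilradicalP/nilpotent0.
  by apply/nilradicalP/nilpotent1.
move=> a x y /nilradicalP xn /nilradicalP yn; apply/nilradicalP.
by apply: nilpotentD => //; exact: nilpotentM.
Qed.

(** Up to units and nilpotents, L is the domain k[X]. *)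
Lemma nilradical_prime : prime_idealr_closed nilradical.
Proof.
move=> x y /nilradicalP xyn.
have [u [u' [f [uu' xf]]]] := iota_approx x.
have [v [v' [g [vv' yg]]]] := iota_approx y.
have fromf z w w' h : w * w' = 1 -> nilpotent (w * z - iota h) -> h = 0 ->
    z \in nilradical.
  move=> ww' zh h0; rewrite h0 rmorph0 subr0 in zh; apply/nilradicalP.
  have -> : z = w' * (w * z) by rewrite mulrA [w' * w]mulrC ww' mul1r.
  exact: nilpotentM.
have : nilpotent (iota (f * g)).
  have -> : iota (f * g) = (u * v) * (x * y) -
     (u * x * (v * y - iota g) + iota g * (u * x - iota f)).
    by rewrite rmorphM; ring.
  by apply: nilpotentB; [|apply: nilpotentD]; apply: nilpotentM.
move=> /iota_nilpotent /eqP; rewrite mulf_eq0 => /orP[] /eqP h0; apply/orP.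
  by left; exact: fromf uu' xf h0.
by right; exact: fromf vv' yg h0.
Qed.

Definition nilradical_idealr : prime_idealr L :=
  HB.pack nilradical
    (isIdealr.Build _ nilradical nilradical_closed)
    (isPrimeIdealrClosed.Build _ nilradical nilradical_prime).

(** A prime contains all nilpotents and no unit, so it is determined by the
    polynomials in it. *)
Lemma mem_prime_approx (Q : prime_idealr L) u v x f :
  u * v = 1 -> nilpotent (u * x - iota f) -> (x \in Q) = (iota f \in Q).
Proof.
move=> uv /(mem_congr Q) <-.
by rewrite prime_idealrM (negPf (unit_notin Q uv)).
Qed.

Lemma prime_separation (Q Q' : prime_idealr L) :
  ~ {subset Q' <= Q} -> exists2 f, iota f \in Q' & iota f \notin Q.
Proof.
move=> nsub; apply: contrapT => nex; apply: nsub => x.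
have [u [v [f [uv xf]]]] := iota_approx x.
rewrite !(mem_prime_approx _ uv xf) => fQ'.
by apply: contraT => fQ; case: nex; exists f.
Qed.

(** Take a nonzero polynomial f in Q1 and a polynomial g in Q2 but not in Q1.
    Their gcd lies in Q2, and not in Q1 since it divides g; hence f / gcd f g is in
    the prime Q1, and the descent only stops at 1 in Q2. *)
Lemma prime_chain3 (Q0 Q1 Q2 : prime_idealr L) :
  {subset Q1 <= Q2} ->
  ~ {subset Q1 <= Q0} -> ~ {subset Q2 <= Q1} -> False.
Proof.
move=> s12 /prime_separation[f fQ1 fQ0] /prime_separation[g gQ2 gQ1].
have f0 : f != 0 by apply: contraNneq fQ0 => ->; rewrite rmorph0 rpred0.
have [n] := ubnP (size f); elim: n f f0 fQ1 {fQ0} => // n IHn f f0 fQ1 le_f_n.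
have comb u v : iota (u * f + v * g) \in Q2.
  by rewrite rmorphD !rmorphM rpredD // idealMr // s12.
case: (gcd_split g f0) => [[u [v uv1]] | [d [e [h [u [v [fde gdh duv lt_ef e0]]]]]]].
  by have := comb u v; rewrite uv1 rmorph1 idealr1.
move: fQ1; rewrite {1}fde rmorphM prime_idealrM => /orP[dQ1 | eQ1].
  by move: gQ1; rewrite gdh rmorphM mulrC idealMr.
by apply: (IHn e) => //; exact: leq_trans lt_ef _.
Qed.

Variable M : prime_idealr L.
Hypothesis M_poly : exists2 f, f != 0 & iota f \in M.

Lemma krull_dim1 : has_krull_dim L 1.
Proof.
split.
  exists (fun i : 'I_2 => if i == ord0 then nilradical_idealr else M).
  move=> [[|[|i]] ilt] // [[|[|j]] jlt] //= _; split.
    by move=> x /nilradicalP; exact: nilpotent_mem_prime.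
  have [f f0 fM] := M_poly; move=> /(_ _ fM) /nilradicalP /iota_nilpotent.
  exact/eqP.
move=> l Q chainQ; rewrite leqNgt; apply/negP => lt1l.
have [lt0 lt1 lt2] : [/\ 0 < l.+1, 1 < l.+1 & 2 < l.+1]%N.
  by case: l lt1l {Q chainQ} => [|[]].
have [//|_ s01] := chainQ (Ordinal lt0) (Ordinal lt1).
have [//|s12 ns12] := chainQ (Ordinal lt1) (Ordinal lt2).
exact: prime_chain3 s12 s01 ns12.
Qed.

Lemma depth1_witness : exists xs : seq L,
  [/\ size xs = 1%N, {subset xs <= M} & regular_sequence xs].
Proof.
have [f f0 fM] := M_poly; exists [:: iota f]; split=> //.
  by move=> x; rewrite inE => /eqP->.
split=> [[|i] // _ r /= | /ideal_span1[c c1]].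
  by move=> /ideal_span_nil e; apply/ideal_span_nil/(iota_reg f0); rewrite mulrC.
by have := idealMr c fM; rewrite -c1 idealr1.
Qed.

(** Let f and g be the polynomials attached to x and y.  Some power of f is a
    multiple of x, and g is regular modulo x because y is.  If h is a nonzero
    polynomial multiple of x, then g (h / gcd h g) = (g / gcd h g) h is a multiple
    of x, so h / gcd h g is one too; descending on h puts a unit in M. *)
Lemma regular_pair_false x y : x \in M -> y \in M ->
  (forall r, r * x = 0 -> r = 0) ->
  (forall r, (exists c, r * y = c * x) -> exists c, r = c * x) -> False.
Proof.
move=> xM yM xreg; pose D r := exists c, r = c * x.
rewrite -/(D _) => yreg.
have DMl a r : D r -> D (a * r) by case=> c ->; exists (a * c); rewrite mulrA.
have DM r : D r -> r \in M by case=> c ->; rewrite idealMr.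
have [u [u' [f [uu' xf]]]] := iota_approx x.
have [v [v' [g [vv' yg]]]] := iota_approx y.
have gM : iota g \in M by rewrite -(mem_prime_approx M vv' yg).
(* Otherwise x would be both nilpotent and regular. *)
have f0 : f != 0.
  apply/eqP => f0; rewrite f0 rmorph0 subr0 in xf; have [n xf0] := xf.
  have : x ^+ n * 1 = 0.
    by rewrite mulr1 -[x]mul1r -uu' [u * u']mulrC -mulrA exprMn xf0 mulr0.
  elim: n {xf0} => [|n IHn]; first by rewrite mul1r => /eqP; rewrite oner_eq0.
  by rewrite exprSr mulrAC => /xreg.
have [n fxn] : nilpotent (iota f - u * x) by rewrite -opprB; exact: nilpotentN.
have fnD : D (iota (f ^+ n)).
  have [c e] := exp_sub_dvd (iota f) (u * x) n.
  by exists (c * u); rewrite rmorphXn e fxn add0r mulrA.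
(* A power of the regular element y is, up to a unit, a multiple of g. *)
have greg r : D (iota g * r) -> D r.
  move=> /DMl grD; have [m yg0] := yg; have [c e] := exp_sub_dvd (v * y) (iota g) m.
  have : D (r * y ^+ m).
    suff -> : r * y ^+ m = v' ^+ m * c * (iota g * r) by [].
    have -> : v' ^+ m * c * (iota g * r) = r * (v' ^+ m * (c * iota g)) by ring.
    have <- : (v * y) ^+ m = c * iota g by rewrite e yg0 add0r.
    by rewrite -exprMn mulrA [v' * v]mulrC vv' mul1r.
  elim: m r {grD yg0 e} => [|m IHm] r; first by rewrite expr0 mulr1.
  by rewrite exprSr mulrA => /yreg /IHm.
have f0n : f ^+ n != 0 by rewrite expf_neq0.
(* Descent on a nonzero polynomial multiple of x, starting from f^n. *)
move: (f ^+ n) f0n fnD => {f0 xf fxn}{}f.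
have [s] := ubnP (size f); elim: s f => // s IHs f le_f_s f0 fD.
case: (gcd_split g f0) => [[p [q pq1]] | [e [e' [h [p [q [fee gh _ lt_ef e0]]]]]]].
  have : iota (p * f + q * g) \in M.
    by rewrite rmorphD !rmorphM rpredD // idealMr // DM.
  by rewrite pq1 rmorph1 idealr1.
apply: (IHs e') => //; first exact: leq_trans lt_ef _.
apply: greg; rewrite gh -rmorphM mulrAC -fee mulrC rmorphM; exact: DMl.
Qed.

Lemma depth_le1 (xs : seq L) :
  {subset xs <= M} -> regular_sequence xs -> (size xs <= 1)%N.
Proof.
case: xs => [|x [|y xs]] // sM [reg _]; exfalso.
apply: (@regular_pair_false x y); rewrite ?sM ?inE ?eqxx ?orbT //.
  move=> r rx0; apply/ideal_span_nil/(reg 0%N) => //.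
  exact/ideal_span_nil.
by move=> r /ideal_span1 ry; apply/ideal_span1/(reg 1%N).
Qed.

Lemma depth1 : has_depth M 1.
Proof. by split; [exact: depth1_witness | exact: depth_le1]. Qed.

End ThickLine.

(** * Localization at a prime ideal *)

Section LocalizationTheory.

Variables (A : comNzRingType) (P : prime_idealr A).
Local Notation L := (localization P).
Implicit Types (r : A) (s : loc_denom P) (x : L).

Definition loc_map r : L := loc_frac r (loc_denom1 P).

Lemma loc_map_zmod_morphism : zmod_morphism loc_map.
Proof.
move=> r r'; rewrite /loc_map -[RHS]/(loc_add _ (loc_opp _)) loc_oppE loc_addE.
apply/loc_fracP; exists 1; rewrite ?idealr1 // val_loc_denomM val_loc_denom1.
ring.
Qed.

Lemma loc_map_monoid_morphism : monoid_morphism loc_map.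
Proof.
split=> [//|r r']; rewrite /loc_map -[RHS]/(loc_mul _ _) loc_mulE.
apply/loc_fracP; exists 1; rewrite ?idealr1 // val_loc_denomM val_loc_denom1.
ring.
Qed.

HB.instance Definition _ :=
  GRing.isZmodMorphism.Build A L loc_map loc_map_zmod_morphism.
HB.instance Definition _ :=
  GRing.isMonoidMorphism.Build A L loc_map loc_map_monoid_morphism.

Lemma loc_fracM r s : loc_frac r s = loc_map r * loc_frac 1 s.
Proof.
rewrite -[RHS]/(loc_mul _ _) loc_mulE.
apply/loc_fracP; exists 1; rewrite ?idealr1 // val_loc_denomM val_loc_denom1.
ring.
Qed.

Lemma loc_mapV s : loc_map (val s) * loc_frac 1 s = 1.
Proof.
rewrite -loc_fracM -[RHS]/(loc_frac 1 (loc_denom1 P)).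
apply/loc_fracP; exists 1; rewrite ?idealr1 // val_loc_denom1.
ring.
Qed.

Lemma loc_map_frac r s : loc_map (val s) * loc_frac r s = loc_map r.
Proof. by rewrite loc_fracM mulrCA loc_mapV mulr1. Qed.

Lemma loc_map_eq0 r : loc_map r = 0 <-> exists2 u, u \notin P & u * r = 0.
Proof.
have -> : 0 = loc_map 0 by rewrite rmorph0.
by split=> [/loc_fracP|ur0]; [|apply/loc_fracP]; rewrite mul0r subr0 mulr1.
Qed.

Lemma mem_loc_frac (J : idealr L) r s : (loc_frac r s \in J) = (loc_map r \in J).
Proof.
apply/idP/idP=> [rJ|rJ]; first by rewrite -(loc_map_frac r s) idealMr.
by rewrite loc_fracM mulrC idealMr.
Qed.

Definition loc_max : {pred L} := fun x =>
  `[< exists r s, r \in P /\ x = loc_frac r s >].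

Lemma loc_maxP r s : (loc_frac r s \in loc_max) = (r \in P).
Proof.
apply/asboolP/idP => [[r' [s' [r'P]]] | rP]; last by exists r, s.
move=> /loc_fracP[u uP] /eqP; rewrite mulrBr subr_eq0 => /eqP e.
have : u * (r * val s') \in P by rewrite e !prime_idealrM r'P orbT.
by rewrite !prime_idealrM (negPf uP) (negPf (valP s')) orbF.
Qed.

Lemma loc_max_closed : idealr_closed loc_max.
Proof.
split.
- by rewrite -[0]/(loc_frac 0 (loc_denom1 P)) loc_maxP rpred0.
- by rewrite -[1]/(loc_frac 1 (loc_denom1 P)) loc_maxP idealr1.
move=> a x y; have [c [t ->]] := loc_fracE a; have [r [s ->]] := loc_fracE x.
have [r' [s' ->]] := loc_fracE y; rewrite !loc_maxP => rP r'P.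
rewrite -[_ + _]/(loc_add (loc_mul _ _) _) loc_mulE loc_addE loc_maxP.
by rewrite rpredD // !prime_idealrM ?rP ?r'P ?orbT.
Qed.

Lemma loc_max_prime : prime_idealr_closed loc_max.
Proof.
move=> x y; have [r [s ->]] := loc_fracE x; have [r' [s' ->]] := loc_fracE y.
by rewrite -[_ * _]/(loc_mul _ _) loc_mulE !loc_maxP prime_idealrM.
Qed.

Definition loc_max_idealr : prime_idealr L :=
  HB.pack loc_max
    (isIdealr.Build _ loc_max loc_max_closed)
    (isPrimeIdealrClosed.Build _ loc_max loc_max_prime).

Lemma loc_max_largest (J : idealr L) : {subset J <= loc_max_idealr}.
Proof.
move=> x; have [r [s ->]] := loc_fracE x; rewrite mem_loc_frac => rJ.
rewrite loc_maxP; apply: contraT => rP.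
by have /negP := unit_notin J (loc_mapV (Sub r rP)).
Qed.

Lemma loc_local : local_ring_at loc_max_idealr.
Proof.
split=> [J _ |J maxJ x]; first exact: loc_max_largest.
by apply/idP/idP; [exact: loc_max_largest | exact: maxJ (@loc_max_largest J) x].
Qed.

(** Every ideal of the localization is generated by its contraction, since a
    fraction differs from its numerator by a unit. *)
Lemma loc_noetherian : noetherian A -> noetherian L.
Proof.
move=> noethA J; pose I : {pred A} := fun r => loc_map r \in J.
have IE r : (r \in I) = (loc_map r \in J) by [].
have I_closed : idealr_closed I.
  split; rewrite ?IE ?rmorph0 ?rpred0 // ?rmorph1 ?idealr1 //.
  by move=> a x y; rewrite !IE rmorphD rmorphM => xJ yJ; rewrite rpredD // idealMr.
pose I' : idealr A := HB.pack I (isIdealr.Build _ I I_closed).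
have [gs gsI] := noethA I'; exists (map loc_map gs) => x; split.
  have [r [s ->]] := loc_fracE x; rewrite mem_loc_frac => rI.
  have /gsI[t [tS ->]] : r \in I' by [].
  rewrite loc_fracM rmorph_sum big_distrl /=.
  exists [seq (loc_frac 1 s * loc_map p.1, loc_map p.2) | p <- t]; split.
    by move=> _ /mapP[q qt ->]; apply: map_f; exact: tS.
  by rewrite big_map; apply: eq_bigr => p _; rewrite rmorphM mulrC mulrA.
move=> [t [tS ->]]; rewrite big_seq rpred_sum // => p /tS /mapP[g gg ->].
rewrite idealMr //; have : g \in I'; last by [].
by apply/gsI; exists [:: (1, g)]; rewrite big_seq1 mul1r; split=> // q /[!inE]/eqP->.
Qed.

End LocalizationTheory.

(** * Finite algebras over k[X] are noetherian *)

Section FiniteModule.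

Variables (k : fieldType) (A : comNzRingType) (iota : {rmorphism {poly k} -> A}).

(** Recursion on the list of generators makes the coefficient at the first one
    accessible, which is what the induction on generators uses. *)
Fixpoint poly_span (es : seq A) (x : A) : Prop :=
  if es is e :: es' then exists f, poly_span es' (x - iota f * e) else x = 0.

Definition poly_submodule (S : A -> Prop) : Prop :=
  S 0 /\ forall f x y, S x -> S y -> S (iota f * x + y).

Lemma poly_span_submodule es : poly_submodule (poly_span es).
Proof.
elim: es => [|e es [IH0 IHD]] /=.
  by split=> // f x y -> ->; rewrite mulr0 addr0.
split=> [|f x y [g xg] [h yh]]; first by exists 0; rewrite rmorph0 mul0r subr0.
exists (f * g + h); rewrite rmorphD rmorphM.
have -> : iota f * x + y - (iota f * iota g + iota h) * e =
  iota f * (x - iota g * e) + (y - iota h * e) by ring.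
exact: IHD.
Qed.

Lemma poly_span_mem es (e : A) f : e \in es -> poly_span es (iota f * e).
Proof.
elim: es => // e' es IHes; rewrite inE => /predU1P[-> | ees] /=.
  by exists f; rewrite subrr; have [] := poly_span_submodule es.
by exists 0; rewrite rmorph0 mul0r subr0; exact: IHes.
Qed.

Lemma poly_span_sum (s : nat -> A) N x : poly_span (mkseq s N) x ->
  exists fs : nat -> {poly k}, x = \sum_(i < N) iota (fs i) * s i.
Proof.
elim: N s x => [|N IHN] s x; first by exists (fun=> 0); rewrite big_ord0.
rewrite /mkseq /= -[1%N]add1n iotaDl -map_comp => -[f /IHN[fs /eqP]].
rewrite subr_eq addrC => /eqP ->.
by exists (fun i => if i is i'.+1 then fs i' else f); rewrite big_ord_recl.
Qed.

(** The coefficients at the first generator e of the elements of S form an ideal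
    of k[X].  An element w of S whose coefficient at e generates it, together with
    generators of the elements of S that need no e, generates S. *)
Lemma poly_submodule_fg es (S : A -> Prop) : poly_submodule S ->
    (forall x, S x -> poly_span es x) ->
  exists gs, (forall g, g \in gs -> S g) /\ (forall x, S x -> poly_span gs x).
Proof.
elim: es S => [|e es IHes] S Ssub Ses; first by exists [::].
have [S0 SD] := Ssub; have [es0 esD] := poly_span_submodule es.
have [||gs [gsS gs_span]] := IHes (fun x => S x /\ poly_span es x).
- by split=> // f x y [xS xes] [yS yes]; split; [exact: SD | exact: esD].
- by move=> x [].
pose head c w := [/\ S w, poly_span es (w - iota c * e) & c != 0].
have [ex_head | no_head] := pselect (exists c w, head c w); last first.
  exists gs; split=> [g /gsS[] // | x xS]; apply: gs_span; split=> //.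
  have [f] := Ses _ xS; have [-> | f0 xf] := eqVneq f 0.
    by rewrite rmorph0 mul0r subr0.
  by case: no_head; exists f, x.
(* A nonzero coefficient of least size generates the ideal of coefficients. *)
have exP : exists n, `[< exists c w, head c w /\ size c = n >].
  by have [c [w cw]] := ex_head; exists (size c); apply/asboolP; exists c, w.
have [n /asboolP[c [w [[wS wc c0] cn]]] n_min] := ex_minnP exP.
exists (w :: gs); split=> [g | x xS /=].
  by rewrite inE => /orP[/eqP-> | /gsS[]].
have [f xf] := Ses _ xS; exists (f %/ c).
have xqS : S (x - iota (f %/ c) * w).
  by rewrite addrC -mulNr -rmorphN; exact: SD.
have xqe : poly_span es (x - iota (f %/ c) * w - iota (f %% c) * e).
  have -> : x - iota (f %/ c) * w - iota (f %% c) * e =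
      iota (- (f %/ c)) * (w - iota c * e) + (x - iota f * e).
    by rewrite {4}(divp_eq f c) rmorphD rmorphM rmorphN; ring.
  exact: esD.
apply: gs_span; split=> //; have [r0 | r0] := eqVneq (f %% c) 0.
  by move: xqe; rewrite r0 rmorph0 mul0r subr0.
have := n_min (size (f %% c)); rewrite -cn leqNgt ltn_modp c0 => absurd.
by exfalso; apply/notF/absurd/asboolP; exists (f %% c), (x - iota (f %/ c) * w).
Qed.

Lemma noetherian_of_finite es : (forall x, poly_span es x) -> noetherian A.
Proof.
move=> es_full I.
have [||gs [gsI gs_span]] := @poly_submodule_fg es (fun x => x \in I) => //.
  by split=> [|f x y xI yI]; [exact: rpred0 | rewrite rpredD // idealMr].
exists gs => x; split=> [/gs_span {gs_span gsI} | [s [sgs ->]]]; last first.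
  by rewrite big_seq rpred_sum // => p /sgs/gsI; exact: idealMr.
elim: gs x => [|g gs IHgs] x /=; first by move=> ->; exact/ideal_span_nil.
move=> [f /IHgs[s [sgs /eqP]]]; rewrite subr_eq => /eqP->.
exists (rcons s (iota f, g)); split; last by rewrite big_rcons /=.
by move=> p; rewrite mem_rcons !inE => /predU1P[-> | /sgs ->]; rewrite ?eqxx ?orbT.
Qed.

End FiniteModule.

(** * Thickened lines are Cohen-Macaulay *)

Section ThickLineCM.

Variables (k : fieldType) (A : comNzRingType) (iota : {rmorphism {poly k} -> A}).
Hypothesis iota_reg : forall f z, f != 0 -> iota f * z = 0 -> z = 0.
Hypothesis iota_approx : forall x, exists f, nilpotent (x - iota f).
Hypothesis iota_finite : exists es, forall x, poly_span iota es x.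

(** If P contained no nonzero polynomial, it would lie in the nilradical, and the
    proper ideal generated by X and the nilradical would be strictly larger. *)
Lemma maximal_poly (P : prime_idealr A) : maximal_ideal P ->
  exists2 f, f != 0 & iota f \in P.
Proof.
move=> maxP; apply: contrapT => noP.
have P0 f : iota f \in P -> f = 0.
  by move=> fP; apply: contrapT => /eqP f0; apply: noP; exists f.
pose J : {pred A} := fun x => `[< exists g, nilpotent (x - iota ('X * g)) >].
have J_closed : idealr_closed J.
  split.
  - by apply/asboolP; exists 0; rewrite mulr0 rmorph0 subr0; exact: nilpotent0.
  - apply/asboolP => [[g]]; rewrite -(rmorph1 iota) -rmorphB.
    move=> /(iota_nilpotent iota_reg)/(congr1 (horner^~ 0))/eqP.
    by rewrite !hornerE subr0 oner_eq0.
  move=> a x y /asboolP[g xg] /asboolP[h yh]; apply/asboolP.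
  have [f af] := iota_approx a; exists (f * g + h).
  have -> : a * x + y - iota ('X * (f * g + h)) =
    a * (x - iota ('X * g)) + iota ('X * g) * (a - iota f) + (y - iota ('X * h)).
    by rewrite !(rmorphD, rmorphM); ring.
  by apply: nilpotentD => //; apply: nilpotentD; apply: nilpotentM.
pose J' : idealr A := HB.pack J (isIdealr.Build _ J J_closed).
have PJ : {subset P <= J'}.
  move=> x xP; have [f xf] := iota_approx x; apply/asboolP; exists 0.
  have f0 : f = 0 by apply: P0; rewrite -(mem_congr P xf).
  by rewrite mulr0 -f0.
have XJ : iota 'X \in J'.
  by apply/asboolP; exists 1; rewrite mulr1 subrr; exact: nilpotent0.
by have /eqP := P0 _ (maxP J' PJ _ XJ); rewrite polyX_eq0.
Qed.

Theorem thick_line_cohen_macaulay : cohen_macaulay A.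
Proof.
have [es es_full] := iota_finite; have noethA := noetherian_of_finite es_full.
split=> // P maxP; split; first exact: loc_noetherian.
exists (loc_max_idealr P); split; first exact: loc_local.
pose iotaL : {rmorphism {poly k} -> localization P} := loc_map P \o iota.
have regL f z : f != 0 -> iotaL f * z = 0 -> z = 0.
  have [r [s ->]] := loc_fracE z => f0.
  move=> /(congr1 ( *%R (loc_map P (val s)))); rewrite mulr0 mulrCA loc_map_frac.
  rewrite /iotaL /= -rmorphM => /loc_map_eq0[u uP]; rewrite mulrCA => /(iota_reg f0) ur0.
  by rewrite loc_fracM (_ : loc_map P r = 0) ?mul0r //; apply/loc_map_eq0; exists u.
have approxL x : exists u v f, u * v = 1 /\ nilpotent (u * x - iotaL f).
  have [r [s ->]] := loc_fracE x; have [f [n rf]] := iota_approx r.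
  exists (loc_map P (val s)), (loc_frac 1 s), f; rewrite loc_mapV loc_map_frac.
  by split=> //; exists n; rewrite /iotaL /= -rmorphB -rmorphXn rf rmorph0.
have [f f0 fP] := maximal_poly maxP.
have polyL : exists2 f, f != 0 & iotaL f \in loc_max_idealr P.
  by exists f; rewrite // loc_maxP.
exists 1%N; split; first exact (krull_dim1 regL approxL polyL).
exact (depth1 regL approxL polyL).
Qed.

End ThickLineCM.

(** * The tangent cone of a monomial curve *)

Section TangentCone.

Variables (k : fieldType) (n : nat) (m : 'I_n -> nat).
Implicit Types (e : 'X_{1..n}) (f g h : {mpoly k[n]}).

Definition weight e : nat := (\sum_(i < n) m i * e i)%N.

Lemma weightD e e' : weight (e + e')%MM = (weight e + weight e')%N.
Proof. by rewrite /weight -big_split /=; apply: eq_bigr => i _; rewrite mnmDE mulnDr. Qed.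

Local Notation param := (mmap (@polyC k) (fun i => 'X^(m i))).

Lemma param_monomial e : param 'X_[e] = 'X^(weight e).
Proof.
rewrite mmapX /mmap1 /weight; elim/big_rec2: _ => [|i s p _ ->]; first by rewrite expr0.
by rewrite exprD exprM.
Qed.

Lemma coef_param f s :
  (param f)`_s = \sum_(e <- msupp f | weight e == s) f@_e.
Proof.
rewrite {1}[f]mpolyE raddf_sum coef_sum [RHS]big_mkcond /=; apply: eq_bigr => e _.
rewrite mmapZ param_monomial coefCM coefXn eq_sym.
by case: eqP => _; rewrite ?mulr1 ?mulr0.
Qed.

Lemma coef_param_pihomog f D s :
  (param (pihomog mdeg D f))`_s =
  \sum_(e <- msupp f | (mdeg e == D) && (weight e == s)) f@_e.
Proof.
rewrite /pihomog raddf_sum coef_sum big_mkcondr /=; apply: eq_bigr => e _.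
rewrite mmapZ param_monomial coefCM coefXn eq_sym.
by case: eqP => _; rewrite ?mulr1 ?mulr0.
Qed.

Lemma least_degree_le f e : e \in msupp f -> (least_degree f <= mdeg e)%N.
Proof.
rewrite /least_degree; elim: (msupp f) => // e' s IHs.
by rewrite inE big_cons geq_min => /predU1P[-> | /IHs ->]; rewrite ?leqnn ?orbT.
Qed.

Lemma le_least_degree f D : f != 0 ->
  (forall e, e \in msupp f -> (D <= mdeg e)%N) -> (D <= least_degree f)%N.
Proof.
move=> f0 Dmin; rewrite /least_degree big_seq; elim/big_ind: _ => //.
- by rewrite (leq_trans (Dmin _ (mlead_supp f0))) // ltnW // msize_mdeg_lt ?mlead_supp.
- by move=> x y; rewrite leq_min => -> ->.
Qed.

(** The monomials of f have degree at least the order of f, and under the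
    hypothesis those of weight s have degree at most that order.  So f and its
    initial form have the same monomials of weight s. *)
Lemma coef_param_initial_form f s : f \in curve_ideal m ->
  (forall e, weight e = s -> (mdeg e <= least_degree f)%N) ->
  (param (initial_form f))`_s = 0.
Proof.
rewrite inE => /eqP fI deg_s; rewrite coef_param_pihomog.
transitivity (param f)`_s; last by rewrite fI coef0.
rewrite coef_param big_seq_cond [RHS]big_seq_cond; apply: eq_bigl => e.
have [ef /= | //] := boolP (e \in msupp f).
have [/deg_s le_e | _] := eqVneq (weight e) s; last by rewrite andbF.
by rewrite eqn_leq le_e least_degree_le.
Qed.

(** This linear form separates classes of monomials in the tangent cone.  On
    X^e times the initial form of f it is zero for degree reasons, unless D is
    deg e plus the order of f; then it reads off the coefficient of the initial
    form at weight s - weight e, and the hypothesis on D says that monomials of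
    this weight have degree at most the order of f. *)
Lemma coef_param_tangent_cone g D s : g \in tangent_cone_ideal m ->
  (forall e, weight e = s -> (mdeg e <= D)%N) ->
  (param (pihomog mdeg D g))`_s = 0.
Proof.
move=> /asboolP[t [tS ->]] deg_s.
rewrite linear_sum raddf_sum coef_sum big_seq big1 //= => p /tS[f [fI _ ->]] {tS t}.
rewrite [p.1]mpolyE big_distrl linear_sum raddf_sum coef_sum big1 //= => e _.
rewrite -scalerAl linearZ mmapZ coefCM /=.
have hom : 'X_[e] * initial_form f \is (mdeg e + least_degree f).-homog.
  by apply: dhomogM; [rewrite dhomogX | exact: pihomogP].
have [degD | neqD] := eqVneq (mdeg e + least_degree f)%N D; last first.
  by rewrite (pihomog_ne0 neqD hom) mmap0 coef0 mulr0.
rewrite pihomog_dE -?degD // rmorphM /= param_monomial coefXnM.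
case: ltnP => [_ | le_es]; rewrite ?mulr0 // coef_param_initial_form ?mulr0 //.
move=> e' we'; have := deg_s (e + e')%MM.
by rewrite weightD we' subnKC // => /(_ erefl); rewrite mdegD -degD leq_add2l.
Qed.

(** The left-hand side is the initial form of the binomial X^e - X^e', which is in
    the curve ideal: these are the only elements of the tangent cone ideal that
    the computation of its quotient uses. *)
Lemma tangent_cone_binomial e e' : weight e = weight e' -> (mdeg e <= mdeg e')%N ->
  e != e' ->
  'X_[k, e] - (if mdeg e' == mdeg e then 'X_[k, e'] else 0) \in tangent_cone_ideal m.
Proof.
move=> eq_w le_deg neq; pose f : {mpoly k[n]} := 'X_[e] - 'X_[e'].
have ef : e \in msupp f.
  rewrite mcoeff_msupp mcoeffB !mcoeffX eqxx [e' == e]eq_sym (negPf neq).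
  by rewrite subr0 oner_neq0.
have f0 : f != 0 by apply: contraTneq ef => ->; rewrite msupp0.
have deg_f : least_degree f = mdeg e.
  apply/eqP; rewrite eqn_leq least_degree_le // le_least_degree // => e''.
  rewrite mcoeff_msupp mcoeffB !mcoeffX.
  case: (e =P e'') => [<- // | _]; case: (e' =P e'') => [<- // | _].
  by rewrite subr0 eqxx.
apply/asboolP; exists [:: (1, initial_form f)]; rewrite big_seq1 mul1r; split.
  move=> _ /[!inE]/eqP-> /=; exists f; split=> //.
  by rewrite inE /f mmapB !param_monomial eq_w subrr.
by rewrite /initial_form deg_f /f pihomogB !pihomogX eqxx.
Qed.

End TangentCone.

(** * Monomials of a curve with exponents in arithmetic progression *)

(** There are q + 2 variables, so that ord_max, the index of the last one, has
    value q + 1. *)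
Section ArithmeticMonomials.

Local Open Scope nat_scope.

Variable q : nat.
Implicit Types (e : 'X_{1..q.+2}) (i j : nat).

Definition steps e : nat := (\sum_(v < q.+2) v * e v)%N.

Lemma stepsD e e' : steps (e + e')%MM = (steps e + steps e')%N.
Proof. by rewrite /steps -big_split /=; apply: eq_bigr => v _; rewrite mnmDE mulnDr. Qed.

Lemma stepsMn e i : steps (e *+ i)%MM = (i * steps e)%N.
Proof. by rewrite /steps big_distrr /=; apply: eq_bigr => v _; rewrite mulmnE; lia. Qed.

Lemma steps1 (v : 'I_q.+2) : steps U_(v) = v.
Proof.
rewrite /steps (bigD1 v) //= mnm1E eqxx muln1 big1 ?addn0 // => w wv.
by rewrite mnm1E eq_sym (negPf wv) muln0.
Qed.

Lemma steps_le e : (steps e <= q.+1 * mdeg e)%N.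
Proof.
rewrite /steps mdegE big_distrr /=; apply: leq_sum => v _.
by rewrite leq_mul2r -ltnS ltn_ord orbT.
Qed.

(** The monomial of least degree with i steps, as [mdeg_top_mono_le] shows: as many
    factors of the last variable as possible, and at most one other factor, of
    index i modulo q + 1.  The degree is the ceiling of i / (q + 1). *)
Definition top_mono i : 'X_{1..q.+2} :=
  (U_(ord_max) *+ (i %/ q.+1)%N + U_(inord (i %% q.+1)%N) *+ (i %% q.+1 != 0)%N)%MM.

Lemma steps_top_mono i : steps (top_mono i) = i.
Proof.
rewrite /top_mono stepsD !stepsMn !steps1 inordK /=; last first.
  by rewrite ltnS ltnW // ltn_pmod.
rewrite [RHS](divn_eq i q.+1); congr (_ + _)%N.
by case: (_ %% _)%N => // r; rewrite mul1n.
Qed.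

Lemma mdeg_top_mono_le i D : (i <= q.+1 * D)%N -> (mdeg (top_mono i) <= D)%N.
Proof.
rewrite /top_mono mdegD !mdegMn !mdeg1 !mul1n {1}(divn_eq i q.+1) mulnC.
by case: (_ %% _)%N => [|r] /=; nia.
Qed.

(** These monomials with i < m0 will form a k-basis of the tangent cone. *)
Definition normal_mono j i : 'X_{1..q.+2} := (U_(ord0) *+ j + top_mono i)%MM.

Lemma steps_normal_mono j i : steps (normal_mono j i) = i.
Proof. by rewrite /normal_mono stepsD stepsMn steps1 muln0 steps_top_mono. Qed.

Lemma mdeg_normal_mono j i : mdeg (normal_mono j i) = (j + mdeg (top_mono i))%N.
Proof. by rewrite /normal_mono mdegD mdegMn mdeg1 mul1n. Qed.

Variables (m0 d : nat).
Definition progression (v : 'I_q.+2) : nat := (m0 + v * d)%N.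

Lemma weight_progression e :
  weight progression e = (m0 * mdeg e + d * steps e)%N.
Proof.
rewrite /weight mdegE /steps !big_distrr -big_split /=; apply: eq_bigr => v _.
by rewrite /progression; lia.
Qed.

Hypothesis m0d : coprime m0 d.

(** If e has the same weight and larger degree, then
    m0 (deg e - deg) = d (i - steps e), so the coprimality of m0 and d makes m0
    divide i - steps e, which lies strictly between 0 and m0. *)
Lemma normal_mono_mdeg_max j i e : (i < m0)%N ->
  weight progression e = weight progression (normal_mono j i) ->
  (mdeg e <= mdeg (normal_mono j i))%N.
Proof.
move=> lt_im; rewrite !weight_progression steps_normal_mono.
set D := mdeg e; set D' := mdeg _ => eqw; rewrite leqNgt; apply/negP => lt_D.
have e1 : (m0 * (D - D') = d * (i - steps e))%N by nia.
have : (m0 %| i - steps e)%N by rewrite -(Gauss_dvdr _ m0d) -e1 dvdn_mulr.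
have [le_is | lt_si] := leqP i (steps e); first by nia.
by move/dvdn_leq; lia.
Qed.

Lemma normal_mono_inj j i j' i' : (0 < d)%N ->
  mdeg (normal_mono j i) = mdeg (normal_mono j' i') ->
  weight progression (normal_mono j i) = weight progression (normal_mono j' i') ->
  j = j' /\ i = i'.
Proof.
move=> d_gt0 eqD; rewrite !weight_progression eqD !steps_normal_mono.
move=> /addnI /eqP; rewrite eqn_pmul2l // => /eqP eqi; split=> //.
by move: eqD; rewrite !mdeg_normal_mono eqi => /addIn.
Qed.

End ArithmeticMonomials.

(** * The tangent cone for an arithmetic progression *)

Section ArithmeticTangentCone.

Variables (k : fieldType) (q m0 d : nat).
Local Notation m := (@progression q m0 d).
Hypothesis (m_gt0 : forall v, (0 < m v)%N).
Hypotheses (m0_gt0 : (0 < m0)%N) (d_gt0 : (0 < d)%N) (m0d : coprime m0 d).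

Local Notation T := (tangent_cone_idealr k m_gt0).
Local Notation A := (tangent_cone_ring k m_gt0).

Local Notation quo := (\pi_{ideal_quot T}).

Lemma quo_eq0 g : (quo g == 0) = (g \in T).
Proof. by rewrite -(rmorph0 quo) -Quotient.idealrBE subr0. Qed.

Lemma quo_eq g h : g - h \in T -> quo g = quo h.
Proof. by move=> ghT; apply/eqP; rewrite -Quotient.idealrBE. Qed.

Definition x0_poly : {poly k} -> {mpoly k[q.+2]} := horner_alg 'X_ord0.
Definition x0_quo (f : {poly k}) : A := quo (x0_poly f).
HB.instance Definition _ := GRing.RMorphism.copy x0_quo (quo \o horner_alg 'X_ord0).

(** Monomials of equal degree and equal number of steps have equal weight. *)
Lemma quo_monomial_low e : (steps e < m0)%N ->
  exists j, quo 'X_[e] = quo 'X_[normal_mono q j (steps e)].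
Proof.
move=> lt_em; have le_top := mdeg_top_mono_le (steps_le e).
exists (mdeg e - mdeg (top_mono q (steps e)))%N; set e' := normal_mono _ _ _.
have mdeg_e' : mdeg e' = mdeg e by rewrite mdeg_normal_mono subnK.
have [-> // | ne] := eqVneq e e'; apply: quo_eq.
have := @tangent_cone_binomial k _ m e e'; rewrite mdeg_e' eqxx; apply=> //.
by rewrite !weight_progression mdeg_e' steps_normal_mono.
Qed.

(** Trading m0 steps for d degrees preserves the weight and raises the degree, so
    the initial form of the resulting binomial is the given monomial. *)
Lemma quo_monomial_high e : (m0 <= steps e)%N -> quo 'X_[e] = 0.
Proof.
move=> le_me; pose i := (steps e - m0)%N.
have le_top : (mdeg (top_mono q i) <= mdeg e)%N.
  by apply/mdeg_top_mono_le/(leq_trans (leq_subr _ _))/steps_le.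
pose e' := normal_mono q (mdeg e + d - mdeg (top_mono q i)) i.
have mdeg_e' : mdeg e' = (mdeg e + d)%N.
  by rewrite mdeg_normal_mono subnK // (leq_trans le_top) // leq_addr.
have ne_deg : (mdeg e' == mdeg e) = false by rewrite mdeg_e'; lia.
apply/eqP; rewrite quo_eq0.
have := @tangent_cone_binomial k _ m e e'; rewrite ne_deg subr0; apply.
- by rewrite !weight_progression mdeg_e' steps_normal_mono /i; nia.
- by rewrite mdeg_e' leq_addr.
- by apply: contraFneq ne_deg => ->.
Qed.

Lemma normal_monoE j i :
  'X_[k, normal_mono q j i] = 'X_ord0 ^+ j * 'X_[top_mono q i].
Proof. by rewrite /normal_mono mpolyXD -mpolyXn. Qed.

Lemma x0_poly_top_mono f i : x0_poly f * 'X_[top_mono q i] =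
  \sum_(j < size f) f`_j *: 'X_[normal_mono q j i].
Proof.
rewrite -{1}[f]coefK poly_def /x0_poly linear_sum big_distrl /=.
apply: eq_bigr => j _; rewrite linearZ rmorphXn /= horner_algX.
by rewrite -scalerAl mul1r -scalerAl normal_monoE.
Qed.

Definition top_class i : A := quo 'X_[top_mono q i].

Lemma x0_quoC c : x0_quo c%:P = quo c%:MP.
Proof. by rewrite /x0_quo /x0_poly horner_algC alg_mpolyC. Qed.

Lemma quo_normal_mono j i :
  quo 'X_[normal_mono q j i] = x0_quo 'X^j * top_class i.
Proof.
rewrite /x0_quo /top_class -rmorphM /x0_poly rmorphXn /= horner_algX.
by rewrite normal_monoE.
Qed.

Lemma quo_ind (Q : A -> Prop) : Q 0 ->
  (forall c x y, Q x -> Q y -> Q (x0_quo c%:P * x + y)) ->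
  (forall e, (steps e < m0)%N -> Q (quo 'X_[e])) -> forall x, Q x.
Proof.
move=> Q0 QD Qlow x; have [g ->] : exists g, x = quo g by exists (repr x); rewrite reprK.
elim/mpolyind: g => [|c e g _ _ IHg]; first by rewrite rmorph0.
rewrite rmorphD -mul_mpolyC rmorphM /= -x0_quoC; apply: QD => //.
by have [/quo_monomial_high -> | /Qlow] := leqP m0 (steps e).
Qed.

Lemma top_class_span x : poly_span x0_quo (mkseq top_class m0) x.
Proof.
have [S0 SD] := poly_span_submodule x0_quo (mkseq top_class m0).
elim/quo_ind: x => // [c x y|e lt_em]; first exact: SD.
have [j ->] := quo_monomial_low lt_em; rewrite quo_normal_mono.
by apply: poly_span_mem; apply: map_f; rewrite mem_iota.
Qed.

(** A monomial with at least one step is nilpotent, since its m0-th power has at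
    least m0 steps; one with no step is a power of x0. *)
Lemma x0_quo_approx x : exists f, nilpotent (x - x0_quo f).
Proof.
elim/quo_ind: x => [|c x y [f xf] [g yg]|e lt_em].
- by exists 0; rewrite rmorph0 subr0; exact: nilpotent0.
- exists (c%:P * f + g).
  have -> : x0_quo c%:P * x + y - x0_quo (c%:P * f + g) =
      x0_quo c%:P * (x - x0_quo f) + (y - x0_quo g) by rewrite rmorphD rmorphM; ring.
  by apply: nilpotentD => //; exact: nilpotentM.
have [e0 | e_gt0] := posnP (steps e).
  have [j ->] := quo_monomial_low lt_em; exists 'X^j.
  rewrite quo_normal_mono e0 (_ : top_class 0 = 1) ?mulr1 ?subrr; first exact: nilpotent0.
  by rewrite /top_class /top_mono div0n mod0n !mulm0n addm0 mpolyX0 rmorph1.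
exists 0, m0; rewrite rmorph0 subr0 -rmorphXn /= mpolyXn.
by rewrite quo_monomial_high // stepsMn; nia.
Qed.

Lemma coef_param_normal f i j i' :
  (mmap (@polyC k) (fun v => 'X^(m v))
     (pihomog mdeg (mdeg (normal_mono q j i')) (x0_poly f * 'X_[top_mono q i])))
     `_(weight m (normal_mono q j i')) = f`_j *+ (i == i').
Proof.
rewrite x0_poly_top_mono linear_sum raddf_sum coef_sum -[in RHS](coefK f) poly_def.
rewrite coef_sum -sumrMnl; apply: eq_bigr => l _.
rewrite linearZ /= mmapZ coefCM coefZ coefXn -mulrnAr; congr (_ * _) => /=.
rewrite -mulrnA mulnb.
have [/andP[/eqP -> /eqP ->] | neq] := boolP ((j == l) && (i == i')).
  by rewrite pihomogX eqxx param_monomial coefXn eqxx.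
rewrite pihomogX; have [eqD | neqD] := eqVneq; last by rewrite mmap0 coef0.
rewrite param_monomial coefXn; have [eqw | //] := eqVneq.
by have [ejl eii] := normal_mono_inj d_gt0 eqD (esym eqw); rewrite ejl eii !eqxx in neq.
Qed.

(** The coefficient of fs i at X^j is recovered by the linear form of
    [coef_param_tangent_cone] in the degree and weight of x0^j S_i. *)
Lemma top_class_free (fs : nat -> {poly k}) :
  \sum_(i < m0) x0_quo (fs i) * top_class i = 0 ->
  forall i, (i < m0)%N -> fs i = 0.
Proof.
move=> sum0 i lt_im; apply/polyP => j; rewrite coef0.
pose g := \sum_(i < m0) x0_poly (fs i) * 'X_[top_mono q i].
have gT : g \in tangent_cone_ideal m.
  rewrite -[_ \in _]/(g \in T) -quo_eq0 rmorph_sum -[X in _ == X]sum0; apply/eqP.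
  by apply: eq_bigr => l _; rewrite rmorphM.
have := coef_param_tangent_cone gT (fun e => @normal_mono_mdeg_max _ _ _ m0d j i e lt_im).
rewrite linear_sum raddf_sum coef_sum (bigD1 (Ordinal lt_im)) //= big1.
  by rewrite coef_param_normal eqxx addr0.
move=> l ne_li; rewrite coef_param_normal.
by rewrite -[l == i :> nat]/(l == Ordinal lt_im) (negPf ne_li).
Qed.

(** A free k[x0]-module is torsion-free. *)
Lemma x0_quo_reg f x : f != 0 -> x0_quo f * x = 0 -> x = 0.
Proof.
move=> f0; have [fs ->] := poly_span_sum (top_class_span x).
rewrite big_distrr /= (eq_bigr (fun i : 'I_m0 => x0_quo (f * fs i) * top_class i)).
  move/(top_class_free (fs := fun i => f * fs i)) => fs0; rewrite big1 // => i _.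
  have /eqP := fs0 i (ltn_ord i); rewrite mulf_eq0 (negPf f0) => /eqP ->.
  by rewrite rmorph0 mul0r.
by move=> i _; rewrite rmorphM mulrA.
Qed.

Lemma progression_cohen_macaulay : cohen_macaulay A.
Proof.
apply: (thick_line_cohen_macaulay (iota := x0_quo)).
- exact: x0_quo_reg.
- exact: x0_quo_approx.
- by exists (mkseq top_class m0); exact: top_class_span.
Qed.

End ArithmeticTangentCone.

Theorem theorem2p5 (k : fieldType) (a d b : nat)
    (a_gt0 : (0 < a)%N) (d_gt0 : (0 < d)%N) (b_in : b \in [:: 1; 2; 3]%N)
    (m_coprime : \big[gcdn/0%N]_(i < 4) curve_exponent a b d i = 1%N) :
  cohen_macaulay (tangent_cone_ring k (curve_exponent_gt0 b d a_gt0)).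
Proof.
apply: (@progression_cohen_macaulay k 2 (3 * a + b) d (curve_exponent_gt0 b d a_gt0)).
- by rewrite addn_gt0 muln_gt0 a_gt0.
- exact: d_gt0.
rewrite /coprime -dvdn1 -[X in (_ %| X)%N]m_coprime.
apply: (big_ind (fun n => gcdn (3 * a + b) d %| n)%N) => // [x y | i _].
  by rewrite dvdn_gcd => -> ->.
by rewrite /curve_exponent dvdn_add ?dvdn_gcdl // dvdn_mull // dvdn_gcdr.
Qed.
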